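(* Let $G=H\rtimes\mathbb{Z}^n$, and let $\rho\colon\mathbb{Z}^n\to\mathbb{R}$ be a non-trivial discrete character. Let $Q\subseteq H$ be a $\rho$-confining subset that is a subgroup. Then the hyperbolic structure $[Q\cup Z_\rho]\in\mathcal{H}(G)$ is represented by a simplicial action on a tree. More precisely, it is represented by the action on the Bass–Serre tree of an ascending HNN-extension expression of $G$, with base group $Q\ker(\rho)$, and stable letter an element $a\in\mathbb{Z}^n$ such that $\rho(a)$ is positive and minimal.
   Context: Semidirect products are internal, and $x^y=y^{-1}xy$. A character is a homomorphism to $\mathbb{R}$; it is discrete if its image is cyclic; $\ker(\rho)\le\mathbb{Z}^n$. A subset $Q\subseteq H$ is $\rho$-confining if $Q=Q^{-1}$ and: $Q^z\subseteq Q$ for all $z\in\mathbb{Z}^n$ with $\rho(z)\ge0$; for every $h\in H$ there is $z\in\mathbb{Z}^n$ with $h^z\in Q$; and there is $z_0\in\mathbb{Z}^n$ with $(Q\cdot Q)^{z_0}\subseteq Q$. Fix a finite generating set $\{a_1,\dots,a_n\}$ of $\mathbb{Z}^n$ and a constant $C_\rho>0$ with $|\rho(a_i)|\le C_\rho$ for all $i$ and such that $C_\rho=\rho(z_{top})$ for some $z_{top}\in\mathbb{Z}^n$; set $Z_\rho=\{z\in\mathbb{Z}^n:|\rho(z)|\le C_\rho\}$. For $\rho$-confining $Q$, $Q\cup Z_\rho$ generates $G$, and it is known that $\mathrm{Cay}(G,Q\cup Z_\rho)$ is hyperbolic. $\mathcal{H}(G)$ is the poset of equivalence classes of cobounded isometric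 actions of $G$ on (geodesic) Gromov hyperbolic spaces, where $G\curvearrowright X\preceq G\curvearrowright Y$ if there is a map $f\colon Y\to X$ that is coarsely Lipschitz and coarsely $G$-equivariant (for every $y$, $\sup_{g\in G}d(f(gy),gf(y))<\infty$), and two actions are equivalent if each dominates the other. For a generating set $A$ with hyperbolic Cayley graph, $[A]$ denotes the class of $G\curvearrowright\mathrm{Cay}(G,A)$; a hyperbolic structure is represented by an action if it is the class of that action. $G$ is expressed as an ascending HNN-extension with base $K\le G$ and stable letter $s\in G$ if $s$ has infinite order, $s^{-1}Ks\le K$, $G=\langle K,s\rangle$ and $\langle s\rangle\cap K=\{1\}$. Its Bass–Serre tree has vertex set $G/K$, with $gK$ joined to $gsK$ for each $g\in G$, with $G$ acting by left multiplication. *)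

(* Defs.v *)
From mathcomp Require Export all_boot all_order all_algebra.
From mathcomp Require Export boolp classical_sets reals.

Set Implicit Arguments.
Unset Strict Implicit.
Unset Printing Implicit Defensive.

Import Order.TTheory GRing.Theory Num.Theory.

Local Open Scope classical_set_scope.
Local Open Scope ring_scope.

(* Subgroups of a possibly infinite group are sets. In [group_scope], [x ^ y]
   is the conjugate y^-1 * (x * y). *)

Definition subgroup (G : groupType) (K : set G) : Prop :=
  group_closed (mem K).

Definition generated (G : groupType) (A : set G) : set G :=
  smallest (@subgroup G) A.

(* G is the internal semidirect product of H with the copy iota(Z^n) of Z^n. *)
Definition semidirect_Zn (G : groupType) (n : nat)
    (H : set G) (iota : 'rV[int]_n -> G) : Prop :=
  [/\ injective iota,
      {morph iota : x y / x + y >-> (x * y)%g},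
      subgroup H /\ (forall h g, H h -> H (h ^ g)%g),
      H `&` range iota = [set 1%g]
    & [set (h * iota z)%g | h in H & z in [set: 'rV[int]_n]] = [set: G]].

Definition discrete_character (R : realType) (n : nat)
    (rho : 'rV[int]_n -> R) : Prop :=
  exists r : R, range rho = range (fun k : int => r *~ k).

Definition confining (R : realType) (G : groupType) (n : nat) (H : set G)
    (iota : 'rV[int]_n -> G) (rho : 'rV[int]_n -> R) (Q : set G) : Prop :=
  [/\ Q `<=` H /\ Q = [set q^-1%g | q in Q],
      forall z, 0 <= rho z -> [set (q ^ iota z)%g | q in Q] `<=` Q,
      forall h, H h -> exists z, Q (h ^ iota z)%g
    & exists z0,
        [set ((q * q') ^ iota z0)%g | q in Q & q' in Q] `<=` Q].

Definition Zrho (R : realType) (G : groupType) (n : nat)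
    (iota : 'rV[int]_n -> G) (rho : 'rV[int]_n -> R) (C : R) : set G :=
  [set iota z | z in [set z | `|rho z| <= C]].

Definition Qker (R : realType) (G : groupType) (n : nat)
    (iota : 'rV[int]_n -> G) (rho : 'rV[int]_n -> R) (Q : set G) : set G :=
  [set (q * iota z)%g | q in Q & z in [set z | rho z = 0]].

Definition ascending_HNN (G : groupType) (K : set G) (s : G) : Prop :=
  [/\ subgroup K,
      forall k : nat, (0 < k)%N -> (s ^+ k)%g <> 1%g,
      [set (x ^ s)%g | x in K] `<=` K,
      generated (K `|` [set s]) = [set: G]
    & generated [set s] `&` K = [set 1%g]].

Record metric_action (R : realType) (G : groupType) := MetricAction {
  point : Type;
  dist : point -> point -> R;
  act : G -> point -> point }.

Section MetricActions.
Variables (R : realType) (G : groupType).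
Implicit Types X Y : metric_action R G.

Definition is_metric X : Prop :=
  [/\ forall x y : point X, 0 <= dist x y,
      forall x y : point X, dist x y = 0 <-> x = y,
      forall x y : point X, dist x y = dist y x
    & forall x y z : point X, dist x z <= dist x y + dist y z].

Definition is_isometric_action X : Prop :=
  [/\ forall x : point X, act 1%g x = x,
      forall g h (x : point X), act (g * h)%g x = act g (act h x)
    & forall g (x y : point X), dist (act g x) (act g y) = dist x y].

Definition is_cobounded X : Prop :=
  exists (x : point X) (B : R),
    forall y : point X, exists g : G, dist y (act g x) <= B.

Definition is_geodesic X (x y : point X) (c : R -> point X) : Prop :=
  [/\ c 0 = x, c (dist x y) = y
    & forall s t, 0 <= s <= dist x y -> 0 <= t <= dist x y ->
        dist (c s) (c t) = `|s - t|].

Definition geodesic_space X : Prop :=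
  forall x y : point X, exists c, is_geodesic x y c.

Definition slim_triangles X : Prop :=
  exists delta : R, forall (x y z : point X) (c1 c2 c3 : R -> point X),
    is_geodesic x y c1 -> is_geodesic y z c2 -> is_geodesic x z c3 ->
    forall t, 0 <= t <= dist x y ->
      (exists2 s, 0 <= s <= dist y z & dist (c1 t) (c2 s) <= delta) \/
      (exists2 s, 0 <= s <= dist x z & dist (c1 t) (c3 s) <= delta).

Definition hyperbolic_action X : Prop :=
  [/\ is_metric X, is_isometric_action X, is_cobounded X,
      geodesic_space X & slim_triangles X].

Definition coarsely_lipschitz X Y (f : point Y -> point X) : Prop :=
  exists K C : R, [/\ 0 <= K, 0 <= C
    & forall y y', dist (f y) (f y') <= K * dist y y' + C].

Definition coarsely_equivariant X Y (f : point Y -> point X) : Prop :=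
  forall y, exists B : R, forall g, dist (f (act g y)) (act g (f y)) <= B.

(* The order of H(G): [dominated X Y] is X <= Y, with f going from Y to X. *)
Definition dominated X Y : Prop :=
  exists f : point Y -> point X,
    coarsely_lipschitz f /\ coarsely_equivariant f.

Definition equivalent_actions X Y : Prop := dominated X Y /\ dominated Y X.

(* Classes of actions are plain predicates: [set (metric_action R G)] would force
   the universe of [point] below that of the spaces constructed later on. *)
Definition structure : Type := metric_action R G -> Prop.

Definition action_class X : structure :=
  fun Y => hyperbolic_action Y /\ equivalent_actions X Y.

Definition hyperbolic_structures (c : structure) : Prop :=
  exists2 X, hyperbolic_action X & c = action_class X.

Definition represented_by (c : structure) X : Prop :=
  hyperbolic_action X /\ c = action_class X.

End MetricActions.

Record simplicial_action (G : groupType) := SimplicialAction {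
  vertex : choiceType;
  adj : rel vertex;
  adj_sym : symmetric adj;
  adj_irrefl : irreflexive adj;
  vact : G -> vertex -> vertex;
  vact1 : forall v, vact 1%g v = v;
  vactM : forall g h v, vact (g * h)%g v = vact g (vact h v);
  vact_adj : forall g u v, adj (vact g u) (vact g v) = adj u v }.

Definition is_tree (G : groupType) (T : simplicial_action G) : Prop :=
  [/\ inhabited (vertex T),
      forall u v : vertex T,
        exists2 p, path (@adj G T) u p & last u p = v
    & forall p : seq (vertex T),
        (2 < size p)%N -> ~ ucycle (@adj G T) p].

Section Realization.
Variables (R : realType) (G : groupType) (T : simplicial_action G).
Local Notation V := (vertex T).

Definition closed_edge (u v : V) : bool := (u == v) || adj u v.

(* A point of the geometric realization, in barycentric coordinates; the case
   u = v gives the vertices. *)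
Definition bary (u v : V) (t : R) : V -> R :=
  fun w => (1 - t) * (w == u)%:R + t * (w == v)%:R.

Definition realization_points : set (V -> R) :=
  [set p | exists u v t, [/\ closed_edge u v, 0 <= t <= 1 & p = bary u v t]].

Definition on_edge (u v : V) (p : V -> R) : Prop :=
  forall w, w != u -> w != v -> p w = 0.

(* Two points of a closed edge {u, v} of length 1 are at distance `|p u - q u|
   along it; [chain p q L] says that p and q are joined by a finite string of
   points, consecutive ones lying on a common closed edge, of total length L. *)
Inductive chain : set_type realization_points -> set_type realization_points -> R -> Prop :=
| chain_nil p : chain p p 0
| chain_cons (u v : V) p q r L :
    closed_edge u v -> on_edge u v (val p) -> on_edge u v (val q) ->
    chain q r L -> chain p r (`|val p u - val q u| + L).

(* The path metric; it is a metric when the graph is connected (otherwise the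
   infimum of the empty set is 0). *)
Definition realization_dist (p q : realization_points) : R :=
  inf [set L | chain p q L].

Lemma realization_actP (g : G) (p : realization_points) :
  (fun v => val p (vact g^-1%g v)) \in realization_points.
Proof.
case: p => p /=; rewrite inE => -[u [v [t [uv t01 ->]]]].
have vactE w x : (vact g^-1%g w == x) = (w == vact g x).
  apply/eqP/eqP => [<-|->]; rewrite -vactM ?mulVg ?mulgV ?vact1 //.
rewrite inE; exists (vact g u), (vact g v), t; split => //.
- rewrite /closed_edge vact_adj; case/orP: uv => [/eqP->|->].
    by rewrite eqxx.
  by rewrite orbT.
- by apply/funext => w; rewrite /bary !vactE.
Qed.

Definition realization_act (g : G) (p : realization_points) :
    realization_points :=
  Sub (fun v => val p (vact g^-1%g v)) (realization_actP g p).

Definition realization : metric_action R G :=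
  @MetricAction R G (set_type realization_points) realization_dist realization_act.

End Realization.

Section Cayley.
Variables (G : groupType) (A : set G).

Definition cayley_adj (g h : G) : bool :=
  `[< g <> h /\ exists2 a, A a & h = (g * a)%g \/ g = (h * a)%g >].

Lemma cayley_adj_sym : symmetric cayley_adj.
Proof.
by move=> g h; apply/asboolP/asboolP => -[gh [a Aa e]];
   (split; [exact: nesym|exists a => //; case: e; [right|left]]).
Qed.

Lemma cayley_adj_irrefl : irreflexive cayley_adj.
Proof. by move=> g; apply/asboolP => -[]. Qed.

Lemma cayley_act1 (v : G) : (1 * v)%g = v. Proof. exact: mul1g. Qed.

Lemma cayley_actM (g h v : G) : (g * h * v)%g = (g * (h * v))%g.
Proof. by rewrite mulgA. Qed.

Lemma cayley_act_adj (g u v : G) :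
  cayley_adj (g * u)%g (g * v)%g = cayley_adj u v.
Proof.
apply/asboolP/asboolP => -[uv [a Aa e]]; split.
- by move=> uv'; apply: uv; rewrite uv'.
- by exists a => //; case: e => e; [left|right]; apply: (mulgI g); rewrite mulgA.
- by move=> /mulgI.
- by exists a => //; case: e => ->; [left|right]; rewrite mulgA.
Qed.

Definition cayley : simplicial_action G :=
  @SimplicialAction G G cayley_adj cayley_adj_sym cayley_adj_irrefl
    (fun g v => (g * v)%g) cayley_act1 cayley_actM cayley_act_adj.

End Cayley.

Section BassSerre.
Variables (G : groupType) (K : set G) (s : G).

Definition left_coset (g : G) : set G := [set (g * k)%g | k in K].

Definition left_cosets : set (set G) := range left_coset.

Lemma translate_coset (g h : G) :
  [set (g * x)%g | x in left_coset h] = left_coset (g * h)%g.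
Proof.
by rewrite /left_coset image_comp; apply: eq_imagel => k _ /=; rewrite mulgA.
Qed.

Lemma bs_actP (g : G) (v : left_cosets) :
  [set (g * x)%g | x in val v] \in left_cosets.
Proof.
case: v => v /=; rewrite inE => -[h _ <-].
by rewrite inE translate_coset; exists (g * h)%g.
Qed.

Definition bs_act (g : G) (v : left_cosets) : left_cosets :=
  Sub [set (g * x)%g | x in val v] (bs_actP g v).

(* Edges join gK and gsK. The requirement u <> v only excludes loops, of which
   there are none when s is not in K. *)
Definition bs_adj (u v : left_cosets) : bool :=
  `[< u <> v /\ exists g,
        (val u = left_coset g /\ val v = left_coset (g * s)%g) \/
        (val v = left_coset g /\ val u = left_coset (g * s)%g) >].

Lemma bs_adj_sym : symmetric bs_adj.
Proof.
by move=> u v; apply/asboolP/asboolP => -[uv [g e]];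
   (split; [exact: nesym|exists g; case: e; [right|left]]).
Qed.

Lemma bs_adj_irrefl : irreflexive bs_adj.
Proof. by move=> u; apply/asboolP => -[]. Qed.

Lemma bs_act1 v : bs_act 1%g v = v.
Proof.
apply: val_inj => /=; rewrite -[RHS]image_id.
by apply: eq_imagel => x _; rewrite mul1g.
Qed.

Lemma bs_actM g h v : bs_act (g * h)%g v = bs_act g (bs_act h v).
Proof.
apply: val_inj => /=; rewrite image_comp.
by apply: eq_imagel => x _ /=; rewrite mulgA.
Qed.

Lemma bs_act_adj g u v : bs_adj (bs_act g u) (bs_act g v) = bs_adj u v.
Proof.
have imp h x y : bs_adj x y -> bs_adj (bs_act h x) (bs_act h y).
  move=> /asboolP[xy [k e]]; apply/asboolP; split.
    move=> /(congr1 (bs_act h^-1%g)).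
    by rewrite -!bs_actM mulVg !bs_act1.
  exists (h * k)%g; case: e => -[ex ey]; [left|right];
    by rewrite /= ex ey !translate_coset mulgA.
apply/idP/idP => [/(imp g^-1%g)|/imp //].
by rewrite -!bs_actM mulVg !bs_act1.
Qed.

Definition bass_serre : simplicial_action G :=
  @SimplicialAction G (set_type left_cosets) bs_adj bs_adj_sym bs_adj_irrefl
    bs_act bs_act1 bs_actM bs_act_adj.

End BassSerre.

(* The class [A]: G acts by left translations on the
   realization of the simple graph with edges {g, ga}, a in A. *)
Definition cayley_structure (R : realType) (G : groupType) (A : set G) :
    structure R G :=
  action_class (realization R (cayley A)).

(* Main.v *)
Require Import Defs.
From mathcomp Require Import ring lra zify.

Set Implicit Arguments.
Unset Strict Implicit.
Unset Printing Implicit Defensive.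

Import Order.TTheory GRing.Theory Num.Theory.

Local Open Scope classical_set_scope.
Local Open Scope ring_scope.

(** Write s for iota(a) and K for Q ker(rho). Since rho(a) generates the image of
    rho, G has a homomorphism onto Z, [hgt], that kills K and sends s to 1. The
    confining property of Q shows that K is a subgroup with s^-1 K s in K, and that
    each g in G satisfies g s^i in s^m K for large i and m = hgt g + i
    ([translate_on_line]). Hence K and s generate G, and [hgt] gives the remaining
    conditions for an ascending HNN-extension ([Qker_ascending_HNN]).

    In the graph on G/K the vertex g K is joined to g s K, which depends on g K only.
    So every vertex has one parent, one level higher for [hgt], and any two vertices
    have a common ancestor. Such a graph is a tree. In its realization, the distance
    of two points of heights x and y is 2 m - x - y, where m is the height at which
    their upward rays meet ([dist_above]); m is an ultrametric, so Gromov's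
    four-point condition holds with constant 0 ([above_dist_four_point]) and
    geodesic triangles are tripods ([four_point_slim]).

    The tree represents the class of the Cayley graph because the two actions
    dominate each other. The map g |-> g K moves adjacent vertices to bounded
    distance: Q lies in K, and z in Zrho translates along the line of the s^m K by
    rho(z) / rho(a) ([cay_dominates_bs]). Conversely, a choice of representatives
    of cosets works, as K has word length at most 2 for the generators Q and Zrho,
    and s is itself a generator ([bs_dominates_cay]). Both comparisons are made on
    vertices and extended to realizations by [vertex_map_dominated]. The tree being
    hyperbolic, it also shows that the class belongs to H(G). *)

(** * Paths in the realization of a graph *)

Section GraphRealization.
Variables (R : realType) (G : groupType) (T : simplicial_action G).
Local Notation V := (vertex T).
Local Notation pt := (set_type (@realization_points R G T)).
Implicit Types (u v w : V) (p q r : pt) (phi : V -> R).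

(** The affine extension of phi along the edge from u to v. Barycentric
    coordinates are themselves the values of such extensions, for indicator
    functions, so quantifying over phi compares two parametrizations of a point
    at once. *)
Definition eval_bary (phi : V -> R) (u v : V) (t : R) : R :=
  (1 - t) * phi u + t * phi v.

(** A point has several presentations: an edge can be read in both directions,
    and a vertex lies on all its edges. Support determines the point up to these
    ambiguities, and none of them changes the value of an affine extension. *)
Lemma bary_supported a b s u v : 0 <= s <= 1 ->
    on_edge u v (@bary R _ T a b s) ->
  exists2 t, 0 <= t <= 1
    & forall phi, eval_bary phi a b s = eval_bary phi u v t.
Proof.
move=> s01 H.
(* A point that is a single vertex c of {u, v} gets parameter 0 or 1. *)
have single c : (forall phi, eval_bary phi a b s = phi c) -> c = u \/ c = v ->
    exists2 t, 0 <= t <= 1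
      & forall phi, eval_bary phi a b s = eval_bary phi u v t.
  move=> e [] <-; [exists 0|exists 1]; rewrite ?lexx ?ler01 // => phi;
    by rewrite e /eval_bary; lra.
have [ab|ab] := eqVneq a b.
  apply: (single a); first by rewrite -ab /eval_bary => phi; lra.
  have [|au] := eqVneq a u; first by left.
  have [|av] := eqVneq a v; first by right.
  have := H a au av; rewrite /bary -ab eqxx !mulr1 subrK => /eqP.
  by rewrite oner_eq0.
have Ha : [\/ a = u, a = v | s = 1].
  have [->|au] := eqVneq a u; first by constructor 1.
  have [->|av] := eqVneq a v; first by constructor 2.
  have := H a au av; rewrite /bary eqxx (negbTE ab) mulr0 addr0 mulr1.
  by move=> h; constructor 3; lra.
have Hb : [\/ b = u, b = v | s = 0].
  have [->|bu] := eqVneq b u; first by constructor 1.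
  have [->|bv] := eqVneq b v; first by constructor 2.
  have := H b bu bv; rewrite /bary eqxx eq_sym (negbTE ab) mulr0 add0r mulr1.
  by move=> h; constructor 3.
have [s0|s0] := eqVneq s 0.
  apply: (single a); first by rewrite s0 /eval_bary => phi; lra.
  by case: Ha => [||/eqP]; [left|right|rewrite s0 eq_sym oner_eq0].
have [s1|s1] := eqVneq s 1.
  apply: (single b); first by rewrite s1 /eval_bary => phi; lra.
  by case: Hb => [||/eqP]; [left|right|rewrite s1 oner_eq0].
case: Ha => [au|av|/eqP]; last by rewrite (negbTE s1).
  case: Hb => [bu|bv|/eqP]; last by rewrite (negbTE s0).
    by move: ab; rewrite au bu eqxx.
  by exists s => // phi; rewrite au bv.
case: Hb => [bu|bv|/eqP]; last by rewrite (negbTE s0).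
  exists (1 - s); first by lra.
  by move=> phi; rewrite av bu /eval_bary; lra.
by move: ab; rewrite av bv eqxx.
Qed.

Lemma bary_eval u v t w :
  @bary R _ T u v t w = eval_bary (fun x => (w == x)%:R) u v t.
Proof. by []. Qed.

(** This makes the affine extension of a vertex function to the realization
    well defined. *)
Lemma bary_eval_inj a b s u v t phi : 0 <= s <= 1 ->
  @bary R _ T a b s = bary u v t -> eval_bary phi a b s = eval_bary phi u v t.
Proof.
move=> s01 e; have [|t' _ h] := @bary_supported a b s u v s01.
  by rewrite e => w wu wv; rewrite /bary (negbTE wu) (negbTE wv) !mulr0 addr0.
rewrite h; have [->|uv] := eqVneq u v; first by rewrite /eval_bary; lra.
have := congr1 (fun f => f v) e; rewrite bary_eval h /= /bary /eval_bary.
rewrite eqxx eq_sym (negbTE uv) !mulr0 !mulr1 !add0r; by move=> ->.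
Qed.

Lemma vertex_ptP v : (@bary R _ T v v 0) \in @realization_points R G T.
Proof. by rewrite inE; exists v, v, 0; rewrite /closed_edge eqxx lexx ler01. Qed.

Definition vertex_pt v : pt := Sub (bary v v 0) (vertex_ptP v).

Lemma realization_pointP p : exists u v t,
  [/\ closed_edge u v, 0 <= t <= 1 & val p = @bary R _ T u v t].
Proof. by have := valP p; rewrite inE. Qed.

Definition base_vertex p : V := sval (cid (realization_pointP p)).

Lemma base_vertexP p : exists v t,
  [/\ closed_edge (base_vertex p) v, 0 <= t <= 1
    & val p = @bary R _ T (base_vertex p) v t].
Proof. by rewrite /base_vertex; case: cid. Qed.

Definition extend_affine (phi : V -> R) p : R :=
  let: exist u h := cid (realization_pointP p) in
  let: exist v h := cid h in let: exist t _ := cid h in eval_bary phi u v t.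

Lemma extend_affineE phi p u v t : 0 <= t <= 1 -> val p = @bary R _ T u v t ->
  extend_affine phi p = eval_bary phi u v t.
Proof.
move=> t01 e; rewrite /extend_affine.
case: cid => u' h; case: (cid h) => v' {}h; case: (cid h) => t' [_ t01' e'].
by apply: bary_eval_inj => //; rewrite -e -e'.
Qed.

Lemma on_edgeP p u v : on_edge u v (val p) ->
  exists2 t, 0 <= t <= 1 & val p = @bary R _ T u v t.
Proof.
have [a [b [s [_ s01 e]]]] := realization_pointP p; rewrite e.
move=> /(bary_supported s01)[t t01 h]; exists t => //.
by apply/funext => w; exact: (h (fun x => (w == x)%:R)).
Qed.

Lemma on_edge_bary u v t : on_edge u v (@bary R _ T u v t).
Proof. by move=> w wu wv; rewrite /bary (negbTE wu) (negbTE wv) !mulr0 addr0. Qed.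

Lemma chain_cat p q r L L' : chain p q L -> chain q r L' -> chain p r (L + L').
Proof.
move=> c; elim: c L' => [p' L'|u v p' q' r' M e pu qu _ IH L' /IH c].
  by rewrite add0r.
by rewrite -addrA; exact: (chain_cons e pu qu c).
Qed.

Lemma chain_edge u v p q : closed_edge u v -> on_edge u v (val p) ->
  on_edge u v (val q) -> chain p q `|val p u - val q u|.
Proof.
move=> e pu qu; rewrite -[X in chain _ _ X]addr0.
exact: (chain_cons e pu qu (chain_nil _)).
Qed.

Lemma chain_rev p q L : chain p q L -> chain q p L.
Proof.
elim=> [p'|u v p' q' r' M e pu qu _ IH]; first exact: chain_nil.
rewrite addrC; apply: (chain_cat IH).
by rewrite distrC; exact: (chain_edge e qu pu).
Qed.

Lemma chain_ge0 p q L : chain p q L -> 0 <= L.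
Proof. by elim=> // u v p' q' r' M _ _ _ _ h; rewrite addr_ge0. Qed.

(** The source of all lower bounds on distances: a function that is Lipschitz
    on each closed edge is Lipschitz for the path metric. *)
Lemma chain_lipschitz (F : pt -> R) (C : R) p q L :
  (forall u v p q, closed_edge u v -> on_edge u v (val p) ->
     on_edge u v (val q) -> F p - F q <= C * `|val p u - val q u|) ->
  chain p q L -> F p - F q <= C * L.
Proof.
move=> hF; elim=> [p'|u v p' q' r' M e pu qu _ IH]; first by rewrite subrr mulr0.
by have := hF _ _ _ _ e pu qu; rewrite mulrDr; lra.
Qed.

Lemma chain_act g p q L : chain p q L ->
  chain (realization_act g p) (realization_act g q) L.
Proof.
elim=> [p'|u v p' q' r' M e pu qu _ IH]; first exact: chain_nil.
have E (x : pt) w : val (realization_act g x) (vact g w) = val x w.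
  by rewrite /= -vactM mulVg vact1.
rewrite -(E p' u) -(E q' u).
have on (x : pt) : on_edge u v (val x) ->
    on_edge (vact g u) (vact g v) (val (realization_act g x)).
  move=> xu w wu wv; apply: xu; [apply: contraNneq wu|apply: contraNneq wv];
    by move=> <-; rewrite -vactM mulgV vact1.
apply: (@chain_cons _ _ _ _ (vact g v)) IH; [|exact: on|exact: on].
by case/orP: e => [/eqP->|e]; rewrite /closed_edge ?eqxx // vact_adj e orbT.
Qed.

Lemma realization_act1 p : realization_act 1%g p = p.
Proof. by apply/val_inj/funext => v /=; rewrite invg1 vact1. Qed.

Lemma realization_actM g h p :
  realization_act (g * h)%g p = realization_act g (realization_act h p).
Proof. by apply/val_inj/funext => v /=; rewrite invgM vactM. Qed.

Lemma realization_act_vertex g v :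
  realization_act g (vertex_pt v) = vertex_pt (vact g v).
Proof.
apply/val_inj/funext => w /=; rewrite /bary.
have -> : (vact g^-1%g w == v) = (w == vact g v).
  by apply/eqP/eqP => [<-|->]; rewrite -vactM ?mulVg ?mulgV vact1.
by [].
Qed.

Lemma realization_dist_le p q L : chain p q L -> realization_dist p q <= L.
Proof.
move=> c; apply: ge_inf => //; exists 0 => M; exact: chain_ge0.
Qed.

Lemma le_realization_dist p q D : (exists L, chain p q L) ->
  (forall L, chain p q L -> D <= L) -> D <= realization_dist p q.
Proof. by move=> [L c] h; apply: lb_le_inf => [|M]; [exists L|exact: h]. Qed.

Lemma realization_distC p q : realization_dist p q = realization_dist q p.
Proof.
by congr inf; apply/seteqP; split=> L; exact: chain_rev.
Qed.

Lemma realization_dist_act g p q :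
  realization_dist (realization_act g p) (realization_act g q) =
  realization_dist p q.
Proof.
congr inf; apply/seteqP; split=> L /=; last exact: chain_act.
by move=> /(chain_act g^-1%g); rewrite -!realization_actM mulVg !realization_act1.
Qed.

Lemma realization_isometric : is_isometric_action (realization R T).
Proof.
split; [exact: realization_act1|exact: realization_actM|exact: realization_dist_act].
Qed.

Lemma chain_adj u v : adj u v -> chain (vertex_pt u) (vertex_pt v) 1.
Proof.
move=> uv; have e : closed_edge u v by rewrite /closed_edge uv orbT.
have nuv : u != v by apply: contraTneq uv => ->; rewrite adj_irrefl.
have -> : 1 = `|val (vertex_pt u) u - val (vertex_pt v) u| :> R.
  rewrite /= /bary eqxx (negbTE nuv) !mul0r !mulr0 !addr0 subr0 mulr1 subr0.
  by rewrite normr1.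
by apply: (chain_edge e) => w wu wv /=;
  rewrite /bary ?(negbTE wu) ?(negbTE wv) !mulr0 addr0.
Qed.

Lemma chain_path u (s : seq V) : path (@adj G T) u s ->
  chain (vertex_pt u) (vertex_pt (last u s)) (size s)%:R.
Proof.
elim: s u => [u _|v s IH u /= /andP[uv /IH c]]; first exact: chain_nil.
by rewrite -natr1 addrC; apply: (chain_cat (chain_adj uv)).
Qed.

Lemma chain_base_vertex p :
  exists2 L, chain p (vertex_pt (base_vertex p)) L & L <= 1.
Proof.
have [v [t [e t01 ep]]] := base_vertexP p; set u := base_vertex p in e ep *.
exists `|val p u - val (vertex_pt u) u|.
  apply: (chain_edge e); first by rewrite ep; exact: on_edge_bary.
  by move=> w wu _; rewrite /= /bary (negbTE wu) !mulr0 addr0.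
rewrite ep /= /bary eqxx ler_norml; case: eqP => _ /=; rewrite ?mulr1n ?mulr0n; lra.
Qed.

(** Without connectedness the path distance of two points in different
    components would be 0, the infimum of the empty set, and the triangle
    inequality would fail. *)
Definition graph_connected :=
  forall u v : V, exists2 s, path (@adj G T) u s & last u s = v.

Lemma path_reverse u v (s : seq V) : path (@adj G T) u s -> last u s = v ->
  exists2 s', path (@adj G T) v s' & last v s' = u.
Proof.
move=> ps <-; exists (rev (belast u s)).
  by rewrite rev_path; apply: sub_path ps => a b; rewrite adj_sym.
by case: s {ps} => //= a s; rewrite rev_cons last_rcons.
Qed.

Hypothesis Tconn : graph_connected.

Lemma chain_exists p q : exists L, chain p q L.
Proof.
have [L c _] := chain_base_vertex p; have [M d _] := chain_base_vertex q.
have [s /chain_path e l] := Tconn (base_vertex p) (base_vertex q).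
exists (L + ((size s)%:R + M)); apply: (chain_cat c).
by apply: (chain_cat e); rewrite l; exact: chain_rev.
Qed.

Lemma realization_dist_triangle p q r :
  realization_dist p r <= realization_dist p q + realization_dist q r.
Proof.
rewrite -lerBlDr; apply: le_realization_dist; first exact: chain_exists.
move=> L c; rewrite lerBlDr -lerBlDl.
apply: le_realization_dist => [|M d]; first exact: chain_exists.
by rewrite lerBlDl; apply/realization_dist_le/(chain_cat c d).
Qed.

Lemma realization_dist_ge0 p q : 0 <= realization_dist p q.
Proof. by apply: le_realization_dist => [|L]; [exact: chain_exists|exact: chain_ge0]. Qed.

Lemma realization_distxx p : realization_dist p p = 0.
Proof.
by apply/eqP; rewrite eq_le realization_dist_ge0 (realization_dist_le (chain_nil p)).
Qed.

Lemma dist_base_vertex p : realization_dist p (vertex_pt (base_vertex p)) <= 1.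
Proof. by have [L /realization_dist_le c /(le_trans c)] := chain_base_vertex p. Qed.

(** Comparing vertices at both ends of a chain directly would lose an additive
    constant at each of its steps, of which there may be many short ones. The
    affine extension has no such loss. *)
Lemma extend_affine_lipschitz phi (C : R) p q : 0 <= C ->
    (forall u v, adj u v -> phi u - phi v <= C) ->
  extend_affine phi p - extend_affine phi q <= C * realization_dist p q.
Proof.
move=> C0 hphi.
have key L : chain p q L -> extend_affine phi p - extend_affine phi q <= C * L.
  apply: chain_lipschitz => u v {}p {}q e /on_edgeP[t t01 ep] /on_edgeP[s s01 eq].
  rewrite (extend_affineE phi t01 ep) (extend_affineE phi s01 eq) ep eq /eval_bary.
  case/orP: e => [/eqP->|e].
    apply: le_trans (mulr_ge0 C0 (normr_ge0 _)); rewrite le_eqVlt.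
    by apply/orP; left; apply/eqP; ring.
  have uv : u != v by apply: contraTneq e => ->; rewrite adj_irrefl.
  have h1 := hphi _ _ e; have h2 := hphi v u (etrans (adj_sym _ _) e).
  rewrite /bary eqxx (negbTE uv) !mulr0 !mulr1 !addr0.
  have -> : (1 - t) * phi u + t * phi v - ((1 - s) * phi u + s * phi v) =
            (s - t) * (phi u - phi v) by ring.
  have -> : 1 - t - (1 - s) = s - t by ring.
  apply: le_trans (ler_norm _) _; rewrite normrM mulrC.
  by apply: ler_wpM2r => //; rewrite ler_norml; lra.
(* Dividing by C turns the bound on all chains into one on their infimum. *)
have [C00|Cn0] := eqVneq C 0.
  by have [L /key] := chain_exists p q; rewrite C00 !mul0r.
have Cgt0 : 0 < C by rewrite lt_neqAle eq_sym Cn0.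
rewrite mulrC -ler_pdivrMr //; apply: le_realization_dist => [|L /key].
  exact: chain_exists.
by rewrite ler_pdivrMr // mulrC.
Qed.
End GraphRealization.

(** * Comparing actions *)

Section Domination.
Variables (R : realType) (G : groupType).
Implicit Types X Y Z : metric_action R G.

Lemma dominated_trans X Y Z :
    (forall x y z : point X, dist x z <= dist x y + dist y z) ->
  dominated X Y -> dominated Y Z -> dominated X Z.
Proof.
move=> tri [f [[K [C [K0 C0 fl]]] fe]] [f' [[K' [C' [K0' C0' fl']]] fe']].
exists (f \o f'); split.
  exists (K * K'), (K * C' + C); split => [||y y'] /=.
  - exact: mulr_ge0.
  - by rewrite addr_ge0 ?mulr_ge0.
  - apply: le_trans (fl _ _) _; rewrite addrA lerD2r -mulrA -mulrDr.
    exact: ler_wpM2l.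
move=> z; have [B hB] := fe' z; have [B' hB'] := fe (f' z).
exists (K * B + C + B') => g /=.
apply: le_trans (tri _ (f (act g (f' z))) _) _; apply: lerD => //.
by apply: le_trans (fl _ _) _; rewrite lerD2r; exact: ler_wpM2l.
Qed.

(** The members of a class are hyperbolic by definition, while X and Y only carry
    comparison maps, whose composition uses the triangle inequality in the
    target. So the class of a Cayley graph is identified with that of a tree by a
    comparison of the two actions alone. *)
Lemma action_class_eq X Y :
    (forall x y z : point X, dist x z <= dist x y + dist y z) ->
    (forall x y z : point Y, dist x z <= dist x y + dist y z) ->
  equivalent_actions X Y -> action_class X = action_class Y.
Proof.
move=> triX triY [XY YX]; apply/funext => Z; apply/propext; split.
  move=> [hZ [XZ ZX]]; split => //; split; first exact: dominated_trans XZ.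
  by have [[_ _ _ triZ] _ _ _ _] := hZ; exact: dominated_trans ZX XY.
move=> [hZ [YZ ZY]]; split => //; split; first exact: dominated_trans YZ.
by have [[_ _ _ triZ] _ _ _ _] := hZ; exact: dominated_trans ZY YX.
Qed.

Lemma vertex_transitive_cobounded (T : simplicial_action G) (v0 : vertex T) :
  graph_connected T -> (forall v, exists g, vact g v0 = v) ->
  is_cobounded (realization R T).
Proof.
move=> Tc tr; exists (vertex_pt R v0), 1 => p.
have [g e] := tr (base_vertex p); exists g.
by rewrite /= realization_act_vertex e; exact: dist_base_vertex.
Qed.

(** Points are sent to the image of a vertex of an edge that carries them. The
    Lipschitz bound is that of [extend_affine_lipschitz], for the function
    measuring the distance to a fixed image vertex. *)
Lemma vertex_map_dominated (S T : simplicial_action G)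
    (f : vertex S -> vertex T) (C B : R) :
    graph_connected S -> graph_connected T -> 0 <= C ->
    (forall u v, adj u v ->
       realization_dist (vertex_pt R (f u)) (vertex_pt R (f v)) <= C) ->
    (forall g v, realization_dist (vertex_pt R (f (vact g v)))
                                  (vertex_pt R (vact g (f v))) <= B) ->
  dominated (realization R T) (realization R S).
Proof.
move=> Sc Tc C0 fC fB.
have fl u v : realization_dist (vertex_pt R (f u)) (vertex_pt R (f v)) <=
    C * realization_dist (vertex_pt R u) (vertex_pt R v).
  pose phi x := realization_dist (vertex_pt R (f x)) (vertex_pt R (f v)).
  have phiE x : extend_affine phi (vertex_pt R x) = phi x.
    rewrite (@extend_affineE _ _ _ _ _ x x 0) ?lexx ?ler01 // /eval_bary.
    by rewrite mul0r addr0 subr0 mul1r.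
  rewrite -[leLHS]/(phi u) -[leLHS]subr0.
  rewrite -(realization_distxx Tc (vertex_pt R (f v))) -/(phi v) -!phiE.
  apply: extend_affine_lipschitz => // x y xy.
  rewrite lerBlDr; apply: le_trans
    (realization_dist_triangle Tc _ (vertex_pt R (f y)) _) _.
  by rewrite lerD2r fC.
pose bp (p : point (realization R S)) := vertex_pt R (base_vertex p).
have bd p : realization_dist (bp p) p <= 1.
  by rewrite realization_distC; exact: dist_base_vertex.
have bl p q : realization_dist (bp p) (bp q) <= realization_dist p q + 2.
  have := realization_dist_triangle Sc (bp p) p (bp q).
  have := realization_dist_triangle Sc p q (bp q).
  have := bd p; have := bd q; rewrite (realization_distC (bp q)); lra.
exists (fun p => vertex_pt R (f (base_vertex p))); split.
  exists C, (C * 2); split => // [|p q]; first by rewrite mulr_ge0.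
  apply: le_trans (fl _ _) _; rewrite -mulrDr.
  by apply: ler_wpM2l => //; exact: bl.
move=> p; exists (C * 2 + B) => g /=; rewrite realization_act_vertex.
apply: le_trans (realization_dist_triangle Tc _
  (vertex_pt R (f (vact g (base_vertex p)))) _) _.
apply: lerD => //; apply: le_trans (fl _ _) _; apply: ler_wpM2l => //.
rewrite -realization_act_vertex.
apply: le_trans (realization_dist_triangle Sc _ (realization_act g p) _) _.
rewrite realization_dist_act -[2]/(1 + 1); apply: lerD; first exact: bd.
exact: dist_base_vertex.
Qed.

End Domination.

(** * Trees given by a parent map *)

(** The 0-hyperbolic case of the equivalence of Gromov's four-point condition
    with thin triangles. A point at distance t from x on a side from x lies, by
    the four-point condition, on the other side from x at the same distance, as
    long as t is at most the Gromov product at x; beyond that, it lies on the side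
    issuing from y. *)
Lemma four_point_slim (R : realType) (G : groupType) (X : metric_action R G) :
    is_metric X ->
    (forall a b c e : point X,
       dist a b + dist c e <= dist a c + dist b e \/
       dist a b + dist c e <= dist a e + dist b c) ->
  slim_triangles X.
Proof.
move=> [_ _ dC tri] fp; exists 0 => x y z c1 c2 c3.
move=> [c10 c1d c1i] [c20 c2d c2i] [c30 c3d c3i] t /andP[t0 td].
have d0 a b : 0 <= dist a b -> 0 <= (0 : R) <= dist a b by rewrite lexx.
have t01 : 0 <= t <= dist x y by rewrite t0 td.
have dxw : dist x (c1 t) = t.
  by rewrite -c10 c1i ?sub0r ?normrN ?ger0_norm // d0 // (le_trans t0).
have dwy : dist (c1 t) y = dist x y - t.
  rewrite -[X in dist _ X = _]c1d c1i ?(le_trans t0) ?lexx //.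
  by rewrite distrC ger0_norm // subr_ge0.
have tri1 := tri x z y; have tri2 := tri x y z; have tri3 := tri y x z.
have zy := dC z y; have yx := dC y x.
have wz := dC (c1 t) z; have wx := dC (c1 t) x.
(* The Gromov product of y and z at x is half of the right-hand side. *)
have [tle|tgt] := lerP (2 * t) (dist x y + dist x z - dist y z).
  right; have t03 : 0 <= t <= dist x z by lra.
  exists t => //.
  have dxp : dist x (c3 t) = t.
    by rewrite -{1}c30 c3i ?sub0r ?normrN ?ger0_norm // d0 // (le_trans t0) //; lra.
  have dpz : dist (c3 t) z = dist x z - t.
    rewrite -[X in dist _ X = _]c3d c3i ?lexx //; last by lra.
    by rewrite distrC ger0_norm // subr_ge0; lra.
  have zp := dC z (c3 t).
  have := fp (c1 t) z x y; have := fp (c1 t) (c3 t) x z.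
  by have := dC z x; have := dC (c3 t) x; lra.
left; have [s es] : exists s, s = dist x y - t by eexists.
have s02 : 0 <= s <= dist y z by lra.
exists s => //.
have dyp : dist y (c2 s) = s.
  rewrite -{1}c20 c2i ?sub0r ?normrN ?ger0_norm //; lra.
have dpz : dist (c2 s) z = dist y z - s.
  rewrite -[X in dist _ X = _]c2d c2i ?lexx //; last by lra.
  by rewrite distrC ger0_norm // subr_ge0; lra.
have zp := dC z (c2 s).
have := fp (c1 t) z y x; have := fp (c1 t) (c2 s) y z.
by have := dC z x; have := dC (c2 s) y; lra.
Qed.

Section ParentTree.
Variables (R : realType) (G : groupType) (T : simplicial_action G).
Local Notation V := (vertex T).
Local Notation pt := (set_type (@realization_points R G T)).
Variables (par : V -> V) (height : V -> int).
(* A directed tree all of whose vertices have one outgoing edge, such that any two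
   rays of successive parents merge; the height is a Busemann function of its
   distinguished end. *)
Hypothesis height_par : forall v, height (par v) = height v + 1.
Hypothesis adjE : forall u v, adj u v = (v == par u) || (u == par v).
Hypothesis common_ancestor : forall u v, exists i j, iter i par u = iter j par v.
Implicit Types (u v w : V) (k l : int) (x y : R) (p q : pt).

Lemma height_iter i v : height (iter i par v) = height v + i%:Z.
Proof. by elim: i => [|i IH] /=; rewrite ?addr0 // height_par IH; lia. Qed.

(** The ancestor of v at height k; meaningful for k at least the height of v. *)
Definition ancestor v k := iter (absz (k - height v)%R) par v.

Lemma ancestor_self v : ancestor v (height v) = v.
Proof. by rewrite /ancestor subrr. Qed.

Lemma ancestorS v k : height v <= k -> ancestor v (k + 1) = par (ancestor v k).
Proof.
move=> vk; rewrite /ancestor.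
by have -> : (absz (k + 1 - height v)%R) = (absz (k - height v)%R).+1 by lia.
Qed.

Lemma height_ancestor v k : height v <= k -> height (ancestor v k) = k.
Proof. by move=> vk; rewrite height_iter; lia. Qed.

Definition meet v w k : Prop :=
  [/\ height v <= k, height w <= k & ancestor v k = ancestor w k].

Lemma meet_sym v w k : meet v w k -> meet w v k.
Proof. by case. Qed.

Lemma meet_trans u v w k : meet u v k -> meet v w k -> meet u w k.
Proof. by move=> [a b c] [d e f]; split => //; rewrite c. Qed.

Lemma meet_mono v w k l : meet v w k -> k <= l -> meet v w l.
Proof.
move=> m kl; have -> : l = k + (absz (l - k)%R) by lia.
elim: (absz (l - k)%R) => [|n [a b c]]; first by rewrite addr0.
have -> : k + n.+1 = k + n + 1 :> int by lia.
by split; rewrite ?ancestorS ?c //; lia.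
Qed.

Lemma meet_exists v w : exists k, meet v w k.
Proof.
have [i [j e]] := common_ancestor v w.
have := congr1 height e; rewrite !height_iter => eh.
exists (height v + i%:Z); split; [lia|lia|].
rewrite /ancestor; have -> : (absz (height v + i - height v)%R) = i by lia.
by have -> : (absz (height v + i - height w)%R) = j by lia.
Qed.

Lemma join_height_exists v w : exists m, forall k, meet v w k <-> m <= k.
Proof.
have [k mk] := meet_exists v w; have [hk _ _] := mk.
have ex : exists i : nat, `[< meet v w (height v + i%:Z) >].
  exists (absz (k - height v)%R); apply/asboolP.
  by have -> : height v + (absz (k - height v)%R) = k by lia.
case: (ex_minnP ex) => i /asboolP mi mini; exists (height v + i%:Z) => l.
split=> [ml|]; last exact: meet_mono mi.
have [hl _ _] := ml.
have /mini : `[< meet v w (height v + (absz (l - height v)%R)%:Z) >].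
  by apply/asboolP; have -> : height v + (absz (l - height v)%R) = l by lia.
lia.
Qed.

(** The height at which the rays of ancestors of v and w merge. It behaves as an
    ultrametric, which is what makes the space 0-hyperbolic. *)
Definition join_height v w : int := sval (cid (join_height_exists v w)).

Lemma join_heightP v w k : meet v w k <-> join_height v w <= k.
Proof. by rewrite /join_height; case: cid. Qed.

Lemma join_heightC v w : join_height v w = join_height w v.
Proof.
have half a b : join_height a b <= join_height b a.
  by apply/join_heightP/meet_sym/join_heightP.
by apply/eqP; rewrite eq_le !half.
Qed.

Lemma join_height_self v : join_height v v = height v.
Proof.
apply/eqP; rewrite eq_le; apply/andP; split; first by apply/join_heightP.
by have /join_heightP[] := lexx (join_height v v).
Qed.

Lemma join_height_ultra u v w :
  join_height u w <= Num.max (join_height u v) (join_height v w).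
Proof.
by apply/join_heightP; apply: (@meet_trans _ v); apply/join_heightP;
  rewrite le_max lexx ?orbT.
Qed.

Lemma join_height_ultraR u v w :
  (join_height u w)%:~R <= (join_height u v)%:~R :> R \/
  (join_height u w)%:~R <= (join_height v w)%:~R :> R.
Proof.
by have := join_height_ultra u v w; rewrite !ler_int le_max;
  move=> /orP[->|->]; [left|right].
Qed.

(** The point at real height x on the ray of ancestors of v, for x at least the
    height of v. The pairs (v, x) parametrize the whole realization, with the
    only identifications (v, x) = (w, x) for x at least [join_height v w]. *)
Definition above_coords v x : V -> R :=
  bary (ancestor v (Num.floor x)) (par (ancestor v (Num.floor x)))
    (x - (Num.floor x)%:~R).

Lemma aboveP v x : above_coords v x \in @realization_points R G T.
Proof.
rewrite inE; do 3 eexists; split; last reflexivity.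
  by rewrite /closed_edge adjE eqxx orbT.
have /andP := floor_itv x; rewrite intrD; lra.
Qed.

Definition above v x : pt := Sub (above_coords v x) (aboveP v x).

(** At an integer height the two adjacent edges of the ray give the same point, so
    both bounds on x can be closed. *)
Lemma above_baryE v k x : height v <= k -> k%:~R <= x <= k%:~R + 1 ->
  val (above v x) = @bary R _ T (ancestor v k) (par (ancestor v k)) (x - k%:~R).
Proof.
move=> vk /andP[kx xk1] /=; rewrite /above_coords.
have [->|xk] := eqVneq x (k%:~R + 1); last first.
  have -> // : Num.floor x = k.
  by apply: floor_def; rewrite kx intrD lt_neqAle xk.
have -> : k%:~R + 1 = (k + 1)%:~R :> R by rewrite intrD.
rewrite intrKfloor ancestorS // intrD; apply/funext => w; rewrite /bary.
by ring.
Qed.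

Lemma above_vertex v : above v (height v)%:~R = vertex_pt R v.
Proof.
apply: val_inj; rewrite (@above_baryE v (height v)) ?lexx ?lerDl ?ler01 //.
by rewrite ancestor_self subrr; apply/funext => w /=; rewrite /bary !mul0r.
Qed.

Lemma above_eq v w x : (join_height v w)%:~R <= x -> above v x = above w x.
Proof.
rewrite -floor_ge_int => /join_heightP[_ _ e].
by apply: val_inj => /=; rewrite /above_coords e.
Qed.

Lemma eval_above_height v x : (height v)%:~R <= x ->
  eval_bary (fun u => (height u)%:~R) (ancestor v (Num.floor x))
    (par (ancestor v (Num.floor x))) (x - (Num.floor x)%:~R) = x.
Proof.
rewrite -floor_ge_int => hv.
by rewrite /eval_bary height_par height_ancestor // intrD; ring.
Qed.

Lemma above_inj v x w y : (height v)%:~R <= x -> (height w)%:~R <= y ->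
  above v x = above w y -> x = y /\ (join_height v w)%:~R <= x.
Proof.
move=> vx wy /(congr1 val) e.
have x01 : 0 <= x - (Num.floor x)%:~R <= 1.
  by have /andP := floor_itv x; rewrite intrD; lra.
have exy : x = y.
  by rewrite -(eval_above_height vx) -(eval_above_height wy); exact: bary_eval_inj.
split => //; subst y; move: vx wy; rewrite -!floor_ge_int => vx wy.
apply/join_heightP; split => //.
set a := ancestor v _ in e *; set b := ancestor w _ in e *.
apply/eqP; apply: contraT => ab.
have bna : a != par b.
  apply/eqP => /(congr1 height); rewrite height_par !height_ancestor //; lia.
have ana : a != par a.
  by apply/eqP => /(congr1 height); rewrite height_par; lia.
have := congr1 (fun f => f a) e; rewrite /= /above_coords /bary -/a -/b.
rewrite eqxx (negbTE ab) (negbTE ana) (negbTE bna) !mulr0 addr0 mulr1.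
by have /andP[_] := floor_itv x; rewrite intrD; lra.
Qed.

Lemma above_exists p : exists v x, (height v)%:~R <= x /\ p = above v x.
Proof.
have [u [v [t [e t01 ep]]]] := realization_pointP p.
have up a s : 0 <= s <= 1 -> val p = @bary R _ T a (par a) s ->
    exists v x, (height v)%:~R <= x /\ p = above v x.
  move=> s01 es; exists a, ((height a)%:~R + s); split; first by lra.
  apply: val_inj; rewrite es (@above_baryE a (height a)) ?lexx //; last by lra.
  by rewrite ancestor_self addrC addKr.
case/orP: e => [/eqP uv|]; last rewrite adjE => /orP[/eqP uv|/eqP uv].
- apply: (up u 0); first by rewrite lexx ler01.
  by rewrite ep uv; apply/funext => w; rewrite /bary; ring.
- by apply: (up u t) => //; rewrite ep uv.
- apply: (up v (1 - t)); first by lra.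
  by rewrite ep uv; apply/funext => w; rewrite /bary; ring.
Qed.

(** The height of the top point of the geodesic between the points (v, x) and
    (w, y): the path goes up to this height and down again. *)
Definition meet_level v x w y : R := Num.max (join_height v w)%:~R (Num.max x y).

Lemma meet_levelP v x w y : [/\ (join_height v w)%:~R <= meet_level v x w y,
  x <= meet_level v x w y, y <= meet_level v x w y
  & [\/ meet_level v x w y = (join_height v w)%:~R,
        meet_level v x w y = x | meet_level v x w y = y]].
Proof.
rewrite /meet_level; set m := (join_height _ _)%:~R.
case: (leP x y) => xy; [case: (leP m y) => h|case: (leP m x) => h];
  split; rewrite ?lexx //; try lra;
  by [constructor 1|constructor 2|constructor 3].
Qed.

Definition above_dist v x w y : R := 2 * meet_level v x w y - x - y.

Lemma meet_level_ultra u x v y w z :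
  meet_level u x w z <= meet_level u x v y \/
  meet_level u x w z <= meet_level v y w z.
Proof.
have [a1 a2 a3 a4] := meet_levelP u x w z.
have [b1 b2 b3 _] := meet_levelP u x v y.
have [c1 c2 c3 _] := meet_levelP v y w z.
have := join_height_ultraR u v w.
by case: a4; lra.
Qed.

Lemma meet_levelC v x w y : meet_level v x w y = meet_level w y v x.
Proof. by rewrite /meet_level join_heightC (maxC x). Qed.

Lemma above_dist_triangle u x v y w z :
  above_dist u x w z <= above_dist u x v y + above_dist v y w z.
Proof.
have [b1 b2 b3 _] := meet_levelP u x v y.
have [c1 c2 c3 _] := meet_levelP v y w z.
by have := meet_level_ultra u x v y w z; rewrite /above_dist; lra.
Qed.

(** With distances written as 2 m - x - y, the heights contribute equally to the
    three sums, and the condition becomes that of the ultrametric m. *)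
Lemma above_dist_four_point v1 x1 v2 x2 v3 x3 v4 x4 :
  let D := above_dist in
  D v1 x1 v2 x2 + D v3 x3 v4 x4 <= D v1 x1 v3 x3 + D v2 x2 v4 x4 \/
  D v1 x1 v2 x2 + D v3 x3 v4 x4 <= D v1 x1 v4 x4 + D v2 x2 v3 x3.
Proof.
move=> /=; rewrite /above_dist.
have := meet_level_ultra v1 x1 v3 x3 v2 x2; have := meet_level_ultra v1 x1 v4 x4 v2 x2.
have := meet_level_ultra v3 x3 v1 x1 v4 x4; have := meet_level_ultra v3 x3 v2 x2 v4 x4.
rewrite (meet_levelC v3 x3 v2) (meet_levelC v3 x3 v1) (meet_levelC v4 x4 v2).
lra.
Qed.

Lemma above_dist_self v x y : (height v)%:~R <= x -> (height v)%:~R <= y ->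
  above_dist v x v y = `|x - y|.
Proof.
move=> vx vy; have := meet_levelP v x v y; rewrite join_height_self /above_dist.
move=> [m1 m2 m3 m4]; have [xy|yx] := leP x y.
  by rewrite ler0_norm ?subr_le0 //; case: m4; lra.
by rewrite gtr0_norm ?subr_gt0 //; case: m4; lra.
Qed.

Lemma above_dist_eq0 v x w y : above_dist v x w y <= 0 -> above v x = above w y.
Proof.
rewrite /above_dist; have [m1 m2 m3 _] := meet_levelP v x w y => h.
have -> : x = y by lra.
by apply: above_eq; lra.
Qed.

Lemma chain_up_step v k x y : height v <= k -> k%:~R <= x -> x <= y ->
  y <= k%:~R + 1 -> chain (above v x) (above v y) (y - x).
Proof.
move=> vk kx xy yk.
have ex := @above_baryE v k x vk; have ey := @above_baryE v k y vk.
have ane : ancestor v k != par (ancestor v k).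
  by apply/eqP => /(congr1 height); rewrite height_par; lia.
have -> : y - x =
    `|val (above v x) (ancestor v k) - val (above v y) (ancestor v k)|.
  rewrite ex ?ey; [|lra..].
  rewrite /bary eqxx (negbTE ane) !mulr0 !mulr1 !addr0.
  by rewrite ger0_norm; lra.
apply: (@chain_edge _ _ _ _ (par (ancestor v k))).
- by rewrite /closed_edge adjE eqxx orbT.
- by rewrite ex; [exact: on_edge_bary|lra].
- by rewrite ey; [exact: on_edge_bary|lra].
Qed.

(** Induction on the number of integer heights passed on the way up. *)
Lemma chain_up v x y : (height v)%:~R <= x -> x <= y ->
  chain (above v x) (above v y) (y - x).
Proof.
rewrite -floor_ge_int => vx xy.
have [n yn] : exists n : nat, y <= (Num.floor x)%:~R + 1 + n%:R.
  have /andP[_ h1] := floor_itv x; have /andP[_ h2] := floor_itv y.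
  have := le_floor xy => hf.
  exists (absz (Num.floor y - Num.floor x)%R).
  rewrite natr_absz ger0_norm ?subr_ge0 // intrB.
  by move: h2; rewrite intrD; lra.
elim: n x vx xy yn => [|n IH] x vx xy yn.
  apply: (chain_up_step vx) => //; first exact: floor_le.
  by rewrite addr0 in yn.
have [yx|xy1] := leP y ((Num.floor x)%:~R + 1).
  by apply: (chain_up_step vx) => //; exact: floor_le.
have /andP[h0 h1] := floor_itv x; rewrite intrD in h1.
have -> : y - x = ((Num.floor x + 1)%:~R - x) + (y - (Num.floor x + 1)%:~R) by ring.
apply: (@chain_cat _ _ _ _ (above v (Num.floor x + 1)%:~R)).
  by apply: (chain_up_step vx) => //; rewrite intrD; lra.
apply: IH; rewrite ?intrKfloor ?intrD; [|lra|].
  by apply: le_trans vx _; rewrite lerDl.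
by move: yn; rewrite -natr1; lra.
Qed.

Lemma chain_above v x w y : (height v)%:~R <= x -> (height w)%:~R <= y ->
  chain (above v x) (above w y) (above_dist v x w y).
Proof.
move=> vx wy; rewrite /above_dist; have := meet_levelP v x w y.
set m := meet_level v x w y => -[m1 m2 m3 _].
have -> : 2 * m - x - y = (m - x) + (m - y) by ring.
apply: chain_cat (chain_up vx m2) _; rewrite (above_eq m1).
by apply: chain_rev; exact: chain_up.
Qed.

(** A closed edge lies on the ray of its lower vertex, where its length parameter
    is the height up to orientation. *)
Lemma edge_above u v : closed_edge u v -> exists a, forall p q,
  on_edge u v (val p) -> on_edge u v (val q) -> exists x y,
  [/\ (height a)%:~R <= x, (height a)%:~R <= y, p = above a x, q = above a y
    & `|x - y| <= `|val p u - val q u|].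
Proof.
have up a s : 0 <= s <= 1 ->
    val (above a ((height a)%:~R + s)) = @bary R _ T a (par a) s.
  move=> s01; rewrite (@above_baryE a (height a)) ?lexx //; last by lra.
  by rewrite ancestor_self addrC addKr.
have apar a : a != par a.
  by apply/eqP => /(congr1 height); rewrite height_par; lia.
have flip a b t : @bary R _ T a b t = bary b a (1 - t).
  by apply/funext => w; rewrite /bary; ring.
rewrite /closed_edge adjE => /or3P[/eqP->|/eqP->|/eqP->].
- exists v => p q /on_edgeP[t _ ep] /on_edgeP[s _ eq].
  exists (height v)%:~R, (height v)%:~R; split=> //; last by rewrite subrr normr0.
    by apply: val_inj; rewrite above_vertex ep; apply/funext => w /=;
    rewrite /bary; ring.
  by apply: val_inj; rewrite above_vertex eq; apply/funext => w /=;
    rewrite /bary; ring.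
- exists u => p q /on_edgeP[t t01 ep] /on_edgeP[s s01 eq].
  exists ((height u)%:~R + t), ((height u)%:~R + s); split; [lra|lra| | |].
  + by apply: val_inj; rewrite up.
  + by apply: val_inj; rewrite up.
  rewrite ep eq /bary eqxx (negbTE (apar u)) !mulr0 !mulr1 !addr0.
  by rewrite -normrN le_eqVlt; apply/orP; left; apply/eqP; congr `|_|; ring.
- exists v => p q /on_edgeP[t t01 ep] /on_edgeP[s s01 eq].
  exists ((height v)%:~R + (1 - t)), ((height v)%:~R + (1 - s)).
  split; [lra|lra| | |].
  + by apply: val_inj; rewrite up ?ep 1?flip //; lra.
  + by apply: val_inj; rewrite up ?eq 1?flip //; lra.
  rewrite ep eq /bary eqxx eq_sym (negbTE (apar v)) !mulr0 !mulr1 !addr0.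
  by rewrite le_eqVlt; apply/orP; left; apply/eqP; congr `|_|; ring.
Qed.

(** The explicit distance to (w, y) is 1-Lipschitz on closed edges, and
    independent of the parameters chosen for a point. *)
Lemma chain_above_ge v x w y L : (height v)%:~R <= x -> (height w)%:~R <= y ->
  chain (above v x) (above w y) L -> above_dist v x w y <= L.
Proof.
move=> vx wy.
pose F p : R := let: exist v' h := cid (above_exists p) in
                let: exist x' _ := cid h in above_dist v' x' w y.
have FE v' x' : (height v')%:~R <= x' -> F (above v' x') = above_dist v' x' w y.
  move=> vx'; rewrite /F; case: cid => v2 h; case: (cid h) => x2 [vx2].
  move=> /(above_inj vx' vx2)[ex hj]; rewrite -ex.
  have := join_height_ultraR v' v2 w; have := join_height_ultraR v2 v' w.
  have := meet_levelP v2 x' w y; have := meet_levelP v' x' w y.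
  rewrite (join_heightC v2 v') /above_dist.
  by move=> [? ? ? h1] [? ? ? h2] ? ?; congr (2 * _ - _ - _); case: h1; case: h2; lra.
move=> /(@chain_lipschitz _ _ _ F 1); rewrite !FE // mul1r.
rewrite above_dist_self // subrr normr0 subr0.
apply => a b p q /edge_above[c hc] pa qa.
have [x1 [x2 [c1 c2 -> ->]]] := hc p q pa qa; rewrite mul1r !FE //.
apply: le_trans; rewrite -(above_dist_self c1 c2) lerBlDr.
exact: above_dist_triangle.
Qed.

Lemma dist_above v x w y : (height v)%:~R <= x -> (height w)%:~R <= y ->
  realization_dist (above v x) (above w y) = above_dist v x w y.
Proof.
move=> vx wy; have c := chain_above vx wy.
apply/eqP; rewrite eq_le realization_dist_le //=.
apply: le_realization_dist; first by eexists; exact: c.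
by move=> L; exact: chain_above_ge.
Qed.

Lemma parent_tree_connected : graph_connected T.
Proof.
have up i u : exists2 s, path (@adj G T) u s & last u s = iter i par u.
  elim: i => [|i [s ps ls]]; first by exists [::].
  exists (rcons s (iter i.+1 par u)); last by rewrite last_rcons.
  by rewrite rcons_path ps ls adjE eqxx.
move=> u v; have [i [j e]] := common_ancestor u v.
have [s ps ls] := up i u; have [s' ps' ls'] := up j v.
have [s2 ps2 ls2] := path_reverse ps' (etrans ls' (esym e)).
by exists (s ++ s2); rewrite ?cat_path ?last_cat ?ps ls.
Qed.

Lemma lowest_vertex (s : seq V) : s != [::] ->
  exists2 v, v \in s & forall w, w \in s -> height v <= height w.
Proof.
elim: s => // a [|b s] IH _.
  by exists a; [rewrite mem_head|move=> w; rewrite inE => /eqP->].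
have [//|v vs hv] := IH.
have [av|va] := leP (height a) (height v).
  exists a => [|w]; first exact: mem_head.
  by rewrite inE => /predU1P[->//|/hv]; exact: le_trans.
exists v => [|w]; first by rewrite inE vs orbT.
by rewrite inE => /predU1P[->|/hv//]; exact: ltW.
Qed.

(** In a cycle, both neighbours of a vertex of least height can only be its
    parent. *)
Lemma parent_tree_is_tree : inhabited V -> is_tree T.
Proof.
move=> inh; split => //; first exact: parent_tree_connected.
move=> s s2 /andP[cs us].
have [|v vs hv] := @lowest_vertex s; first by case: s s2 {cs us}.
have [i s' es] := rot_to vs.
have hv' w : w \in s' -> adj v w -> w = par v.
  move=> ws; rewrite adjE => /orP[/eqP->//|/eqP e].
  have : w \in s by rewrite -(mem_rot i) es inE ws orbT.
  by move/hv; rewrite e height_par; lia.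
have := us; rewrite -(rot_uniq i) es /= => /andP[_ us'].
have := cs; rewrite -(rot_cycle i) es /= rcons_path => /andP[ps].
have : (1 < size s')%N by move: s2; rewrite -(size_rot i) es.
case/lastP: s' hv' us' ps {es} => // [[|b s']] c //= hv'.
rewrite last_rcons => /andP[+ _] /andP[vb _] _.
move=> cb cv; have cp : c = par v.
  by apply: hv'; [rewrite inE mem_rcons mem_head orbT|rewrite adj_sym].
have bp : b = par v by apply: hv' vb; exact: mem_head.
by move: cb; rewrite cp bp mem_rcons mem_head.
Qed.

Lemma parent_tree_metric : is_metric (realization R T).
Proof.
have Tc := parent_tree_connected; split.
- exact: realization_dist_ge0.
- move=> p q; split=> [|->]; last exact: realization_distxx.
  have [v [x [vx ->]]] := above_exists p; have [w [y [wy ->]]] := above_exists q.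
  by rewrite /= dist_above // => e; apply: above_dist_eq0; rewrite e.
- exact: realization_distC.
- exact: realization_dist_triangle.
Qed.

(** The geodesic goes up from (v, x) to the meeting height m, which takes time
    m - x, and then follows the ray of w downwards. *)
Lemma parent_tree_geodesic : geodesic_space (realization R T).
Proof.
move=> p q; have [v [x [vx ->]]] := above_exists p.
have [w [y [wy ->]]] := above_exists q.
set m := meet_level v x w y.
have := meet_levelP v x w y; rewrite -/m => -[m1 m2 m3 m4].
exists (fun s => if s <= m - x then above v (x + s) else above w (2 * m - x - s)).
rewrite /is_geodesic /= dist_above // /above_dist -/m; split.
- by rewrite subr_ge0 m2 addr0.
- case: leP => h; last by congr above; ring.
  have -> : x + (2 * m - x - y) = y by lra.
  by apply: above_eq; lra.
move=> s t s01 t01.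
have mixed s' t' : 0 <= s' <= m - x -> m - x < t' <= 2 * m - x - y ->
    realization_dist (above v (x + s')) (above w (2 * m - x - t')) = `|s' - t'|.
  move=> s01' t01'; rewrite dist_above; [|lra..].
  rewrite ltr0_norm; last lra.
  have := meet_levelP v (x + s') w (2 * m - x - t'); rewrite /above_dist.
  by move=> [h1 h2 h3 h4]; case: h4; case: m4; lra.
have [sm|sm] := leP s (m - x); have [tm|tm] := leP t (m - x).
- rewrite dist_above ?above_dist_self; [|lra..].
  by congr `|_|; ring.
- by apply: mixed; lra.
- by rewrite realization_distC distrC; apply: mixed; lra.
- rewrite dist_above ?above_dist_self; [|lra..].
  by rewrite -normrN; congr `|_|; ring.
Qed.

Lemma parent_tree_hyperbolic (v0 : V) : (forall v, exists g, vact g v0 = v) ->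
  hyperbolic_action (realization R T).
Proof.
move=> tr; split.
- exact: parent_tree_metric.
- exact: realization_isometric.
- exact: vertex_transitive_cobounded parent_tree_connected tr.
- exact: parent_tree_geodesic.
apply: four_point_slim parent_tree_metric _ => a b c e.
have [v1 [x1 [h1 ->]]] := above_exists a; have [v2 [x2 [h2 ->]]] := above_exists b.
have [v3 [x3 [h3 ->]]] := above_exists c; have [v4 [x4 [h4 ->]]] := above_exists e.
by rewrite /= !dist_above //; exact: above_dist_four_point.
Qed.

End ParentTree.

(** * Subgroups and Cayley graphs *)

Lemma subgroupP (G : groupType) (K : set G) :
  subgroup K <-> K 1%g /\ forall x y, K x -> K y -> K (x / y)%g.
Proof.
split=> -[K1 KB].
  split=> [|x y Kx Ky]; first by move: K1; rewrite inE.
  by have := KB x y; rewrite !inE; apply.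
by split=> [|x y]; rewrite !inE //; exact: KB.
Qed.

Section Subgroups.
Variables (G : groupType) (K : set G).
Hypothesis Kgrp : subgroup K.

Lemma sub_1 : K 1%g. Proof. by case/subgroupP: Kgrp. Qed.

Lemma sub_div x y : K x -> K y -> K (x / y)%g.
Proof. by case/subgroupP: Kgrp => _; apply. Qed.

Lemma sub_inv x : K x -> K x^-1%g.
Proof. by move=> Kx; rewrite -[(_^-1)%g]mul1g; apply: sub_div => //; exact: sub_1. Qed.

Lemma sub_mul x y : K x -> K y -> K (x * y)%g.
Proof. by move=> Kx Ky; rewrite -[y]invgK; apply: sub_div => //; exact: sub_inv. Qed.

Lemma left_coset_eq g h : (left_coset K g = left_coset K h) <-> K (g^-1 * h)%g.
Proof.
split=> [e|Kgh].
  have [k Kk <-] : left_coset K g h.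
    by rewrite e; exists 1%g; [exact: sub_1|rewrite mulg1].
  by rewrite mulKg.
apply/seteqP; split=> _ [k Kk <-].
  exists (h^-1 * g * k)%g; last by rewrite -!mulgA mulVKg.
  by apply: sub_mul => //; rewrite -[g]invgK -invgM; exact: sub_inv.
by exists (g^-1 * h * k)%g; [exact: sub_mul|rewrite -!mulgA mulVKg].
Qed.

End Subgroups.

Lemma generated_sub (G : groupType) (A S : set G) :
  subgroup S -> A `<=` S -> generated A `<=` S.
Proof. by move=> gS AS g; apply. Qed.

Lemma generated_subgroup (G : groupType) (A : set G) : subgroup (generated A).
Proof.
apply/subgroupP; split=> [|x y Ax Ay] S [gS AS]; first exact: sub_1.
by apply: sub_div => //; [exact: Ax|exact: Ay].
Qed.

Lemma sub_generated (G : groupType) (A : set G) : A `<=` generated A.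
Proof. by move=> g Ag S [_]; apply. Qed.

(** The elements g such that u and u g are always joined by a path form a
    subgroup. *)
Lemma cayley_connected (G : groupType) (A : set G) :
  generated A = [set: G] -> graph_connected (cayley A).
Proof.
move=> gA; pose S : set G := [set g | forall u, exists2 s,
  path (@adj _ (cayley A)) u s & last u s = (u * g)%g].
suff SA : generated A `<=` S.
  move=> u v; have [|s ps ls] := SA (u^-1 * v)%g _ u; first by rewrite gA.
  by exists s; rewrite // ls mulVKg.
apply: generated_sub.
  apply/subgroupP; split=> [u|x y Sx Sy u]; first by exists [::]; rewrite ?mulg1.
  have [s ps ls] := Sx u; have [t pt lt] := Sy (u * (x / y))%g.
  rewrite -mulgA mulgVK in lt.
  have [t' pt' lt'] := path_reverse pt lt.
  by exists (s ++ t'); rewrite ?cat_path ?last_cat ?ps ls.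
move=> g Ag u; have [<-|gn] := pselect (u = u * g)%g; first by exists [::].
exists [:: u * g]%g; rewrite //= andbT; apply/asboolP; split => //.
by exists g => //; left.
Qed.

(** * The ascending HNN-extension *)

Lemma minimal_positive_exists (R : realType) (n : nat)
    (rho : {additive 'rV[int]_n -> R}) :
  (exists z, rho z <> 0) -> discrete_character rho ->
  exists a, 0 < rho a /\ forall z, 0 < rho z -> rho a <= rho z.
Proof.
move=> [z0 rz0] [r er].
have mul z : exists k : int, rho z = r *~ k.
  have : range rho (rho z) by exists z.
  by rewrite er => -[k _ <-]; exists k.
have rn0 : r != 0.
  by apply/eqP => r0; apply: rz0; have [k ->] := mul z0; rewrite r0 mul0rz.
have [b eb] : exists b, rho b = r.
  have : range (fun k : int => r *~ k) r by exists 1; rewrite ?mulr1z.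
  by rewrite -er => -[b _ <-]; exists b.
have [a ea] : exists a, rho a = `|r|.
  by case: (ger0P r) => _; [exists b|exists (- b); rewrite raddfN /= eb].
exists a; rewrite ea normr_gt0; split=> // z.
have [k ->] := mul z; rewrite -[r *~ k]mulrzr => rk0.
have k0 : k != 0 by apply: contraTneq rk0 => ->; rewrite mulr0 ltxx.
rewrite -(gtr0_norm rk0) normrM ler_peMr // -intr_norm ler1z.
by rewrite -gtz0_ge1 normr_gt0.
Qed.

Section SemidirectProduct.
Variables (R : realType) (G : groupType) (n : nat)
    (H : set G) (iota : 'rV[int]_n -> G)
    (HG : semidirect_Zn H iota)
    (rho : {additive 'rV[int]_n -> R})
    (Q : set G) (Q_confining : confining H iota rho Q)
    (Q_subgroup : subgroup Q).

Let iotaD x y : iota (x + y) = (iota x * iota y)%g.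
Proof. by case: HG. Qed.

Let iota_inj : injective iota.
Proof. by case: HG. Qed.

Let iota0 : iota 0 = 1%g.
Proof. by apply: (mulgI (iota 0)); rewrite -iotaD mulg1 addr0. Qed.

Let iotaN z : iota (- z) = (iota z)^-1%g.
Proof. by apply: (mulgI (iota z)); rewrite -iotaD mulgV subrr. Qed.

Let iota_comm x y : (iota x * iota y)%g = (iota y * iota x)%g.
Proof. by rewrite -!iotaD addrC. Qed.

Let Hgrp : subgroup H.
Proof. by case: HG => _ _ []. Qed.

Let HJ h g : H h -> H (h ^ g)%g.
Proof. by case: HG => _ _ [_ h'] _ _; exact: h'. Qed.

Lemma decomposition g : exists z h, H h /\ g = (h * iota z)%g.
Proof.
case: HG => _ _ _ _ e; have : [set: G] g by [].
by rewrite -e => -[h Hh [z _ <-]]; exists z, h.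
Qed.

Definition Zpart g : 'rV[int]_n := sval (cid (decomposition g)).

Lemma H_iota z : H (iota z) -> z = 0.
Proof.
move=> Hz; apply: iota_inj; rewrite iota0.
have [_ _ _ e _] := HG; have : (H `&` range iota) (iota z) by split => //; exists z.
by rewrite e.
Qed.

Lemma ZpartE h z : H h -> Zpart (h * iota z)%g = z.
Proof.
move=> Hh; rewrite /Zpart; case: cid => z' /= [h' [Hh' e]].
apply/eqP; rewrite -subr_eq0; apply/eqP/H_iota; rewrite iotaD iotaN.
have -> : (iota z' / iota z)%g = (h'^-1 * h)%g.
  by apply: (mulgI h'); rewrite mulgA -e mulgK mulVKg.
by apply: sub_mul => //; exact: sub_inv.
Qed.

Lemma ZpartM g g' : Zpart (g * g')%g = Zpart g + Zpart g'.
Proof.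
have [z [h [Hh ->]]] := decomposition g; have [z' [h' [Hh' ->]]] := decomposition g'.
rewrite !ZpartE //.
have -> : (h * iota z * (h' * iota z') = (h * h' ^ (iota z)^-1) * iota (z + z'))%g.
  by rewrite conjgE invgK iotaD !mulgA mulgVK.
by rewrite ZpartE //; apply: sub_mul => //; exact: HJ.
Qed.

Lemma Zpart_iota z : Zpart (iota z) = z.
Proof. by rewrite -[iota z]mul1g ZpartE //; exact: sub_1. Qed.

Lemma Zpart_H h : H h -> Zpart h = 0.
Proof. by move=> Hh; rewrite -[h]mulg1 -iota0 ZpartE. Qed.

Let QH q : Q q -> H q.
Proof. by case: Q_confining => -[+ _] _ _ _; apply. Qed.

Let QJ q z : Q q -> 0 <= rho z -> Q (q ^ iota z)%g.
Proof. by case: Q_confining => _ h _ _ Qq /h; apply; exists q. Qed.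

Local Notation K := (Qker iota rho Q).

Lemma Q_sub_K q : Q q -> K q.
Proof. by move=> Qq; exists q => //; exists 0; [rewrite /= raddf0|rewrite iota0 mulg1]. Qed.

Lemma ker_sub_K z : rho z = 0 -> K (iota z).
Proof. by move=> rz; exists 1%g; [exact: sub_1|exists z; rewrite ?mul1g]. Qed.

(** Elements z of the kernel satisfy rho z >= 0 and rho (- z) >= 0, so they
    normalize Q. *)
Lemma Qker_subgroup : subgroup K.
Proof.
apply/subgroupP; split=> [|_ _ [q Qq [z rz <-]] [q' Qq' [z' rz' <-]]].
  by apply: Q_sub_K; exact: sub_1.
have rw : rho (z - z') = 0 by rewrite raddfB /= rz rz' subrr.
exists (q * (q'^-1 ^ iota (- (z - z'))))%g.
  apply: sub_mul => //; apply: QJ; first exact: sub_inv.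
  by rewrite raddfN /= rw oppr0.
exists (z - z'); first exact: rw.
by rewrite iotaN -mulgA -conjgCV iotaD iotaN invgM !mulgA.
Qed.

Variable a : 'rV[int]_n.
Hypothesis a_gt0 : 0 < rho a.
Hypothesis a_min : forall z, 0 < rho z -> rho a <= rho z.
Local Notation s := (iota a).

(** The remainder of the division of rho z by rho a is a value of rho below the
    least positive one, hence 0. *)
Lemma rho_multiple z : exists k : int, rho z = rho a *~ k.
Proof.
pose k := Num.floor (rho z / rho a); exists k.
have /andP[k0 k1] := floor_itv (rho z / rho a).
have r0 : 0 <= rho (z - a *~ k).
  rewrite raddfB /= raddfMz /= -[rho a *~ k]mulrzr mulrC subr_ge0.
  by rewrite -ler_pdivlMr.
have r1 : rho (z - a *~ k) < rho a.
  rewrite raddfB /= raddfMz /= -[rho a *~ k]mulrzr mulrC ltrBlDr.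
  by move: k1; rewrite ltr_pdivrMr // intrD mulrDl mul1r addrC.
apply/eqP; rewrite -subr_eq0 -raddfMz -raddfB /= -[_ == 0]negbK.
apply/negP => rn0; have : 0 < rho (z - a *~ k) by rewrite lt_neqAle eq_sym rn0.
by move=> /a_min; rewrite leNgt r1.
Qed.

Definition level z : int := sval (cid (rho_multiple z)).

Lemma levelP z : rho z = rho a *~ level z.
Proof. by rewrite /level; case: cid. Qed.

Lemma rho_a_mulz k l : rho a *~ k <= rho a *~ l -> k <= l.
Proof. by rewrite ler_pMz2l. Qed.

Lemma level_unique z k : rho z = rho a *~ k -> level z = k.
Proof.
by rewrite levelP => e; apply/eqP; rewrite eq_le; apply/andP; split;
  apply: rho_a_mulz; rewrite e.
Qed.

Lemma levelD z z' : level (z + z') = level z + level z'.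
Proof. by apply: level_unique; rewrite raddfD /= (levelP z) (levelP z') mulrzDr. Qed.

Lemma level_mulz k : level (a *~ k) = k.
Proof. by apply: level_unique; rewrite raddfMz. Qed.

Lemma level_ker z : rho z = 0 -> level z = 0.
Proof. by move=> rz; apply: level_unique; rewrite rz mulr0z. Qed.

Lemma rho_residue z : rho (z - a *~ level z) = 0.
Proof. by rewrite raddfB /= raddfMz /= -levelP subrr. Qed.

Lemma rho_level_le z z' : level z <= level z' -> rho z <= rho z'.
Proof. by move=> h; rewrite (levelP z) (levelP z') ler_pMz2l. Qed.

(** The homomorphism from G onto Z that kills Q ker(rho) and sends a to 1; it will
    be the height on the tree. *)
Definition hgt g : int := level (Zpart g).

Lemma hgtM g g' : hgt (g * g')%g = hgt g + hgt g'.
Proof. by rewrite /hgt ZpartM levelD. Qed.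

Lemma hgt_K k : K k -> hgt k = 0.
Proof.
move=> [q Qq [z rz <-]]; rewrite hgtM /hgt Zpart_iota (Zpart_H (QH Qq)).
by rewrite !level_ker ?raddf0.
Qed.

Lemma hgt_s : hgt s = 1.
Proof. by rewrite /hgt Zpart_iota -[a]mulr1z level_mulz. Qed.

Lemma iotaMn (m : nat) : (s ^+ m)%g = iota (a *~ m).
Proof.
elim: m => [|m IH]; first by rewrite expg0 mulr0z iota0.
by rewrite expgS IH -iotaD intS mulrzDr.
Qed.

(** For g = h iota(z) and y = z + i a, one has g a^i = iota(y) h^(iota y), and the
    conjugate of h enters Q once i is large. So every coset g K eventually joins
    the line of the cosets a^m K: this gives both the generation of G by K and a,
    and common ancestors in the tree. *)
Lemma translate_on_line g : exists i0 : nat, forall i : nat, (i0 <= i)%N ->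
  exists2 k, K k & (g * s ^+ i = iota (a *~ (hgt g + i)) * k)%g.
Proof.
have [z [h [Hh ->]]] := decomposition g.
have [w Qw] : exists w, Q (h ^ iota w)%g by case: Q_confining => _ _ h3 _; exact: h3.
exists (absz (level w - level z)%R) => i le_i.
have hz : hgt (h * iota z)%g = level z by rewrite /hgt ZpartE.
pose y := z + a *~ i.
have ly : level y = level z + i by rewrite levelD level_mulz.
have Qy : Q (h ^ iota y)%g.
  have -> : (h ^ iota y = (h ^ iota w) ^ iota (y - w))%g.
    by rewrite -conjgM -iotaD addrC subrK.
  apply: QJ => //; rewrite raddfB subr_ge0; apply: rho_level_le.
  by rewrite ly; lia.
exists (iota (y - a *~ level y) * h ^ iota y)%g.
  apply: sub_mul (Qker_subgroup) _ _ _ _; last exact: Q_sub_K.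
  by apply: ker_sub_K; exact: rho_residue.
rewrite hz -ly mulgA -iotaD addrC subrK -conjgC /y iotaD mulgA iotaMn.
by [].
Qed.

Let Kgrp := Qker_subgroup.

Lemma s_conj_K x : K x -> K (x ^ s)%g.
Proof.
move=> [q Qq [z rz <-]]; rewrite conjMg.
apply: sub_mul => //; first by apply/Q_sub_K/QJ => //; exact: ltW.
by rewrite conjgE (iota_comm z) mulKg; exact: ker_sub_K.
Qed.

Lemma cycle_s : generated [set s] `<=` range (fun m : int => iota (a *~ m)).
Proof.
apply: generated_sub => [|_ ->]; last by exists 1; rewrite ?mulr1z.
apply/subgroupP; split=> [|_ _ [k _ <-] [l _ <-]]; first by exists 0; rewrite ?mulr0z.
by exists (k - l); rewrite // mulrzBr iotaD iotaN.
Qed.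

Lemma subgroup_a_mulz (S : set G) (m : int) : subgroup S -> S s -> S (iota (a *~ m)).
Proof.
move=> gS Ss; have pos (k : nat) : S (iota (a *~ k)).
  elim: k => [|k IH]; first by rewrite mulr0z iota0; exact: sub_1.
  by rewrite intS mulrzDr iotaD; exact: sub_mul.
case: m => k //; rewrite NegzE mulrNz iotaN; exact: sub_inv.
Qed.

Lemma generated_K_s : generated (K `|` [set s]) = [set: G].
Proof.
apply/seteqP; split=> // g _ S [gS KsS].
have Ss : S s by apply: KsS; right.
have [i0 /(_ i0 (leqnn _))[k Kk e]] := translate_on_line g.
rewrite -(mulgK (s ^+ i0)%g g) e iotaMn.
apply: sub_div => //; last exact: subgroup_a_mulz.
by apply: sub_mul => //; [exact: subgroup_a_mulz|apply: KsS; left].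
Qed.

Lemma Qker_ascending_HNN : ascending_HNN K s.
Proof.
split; [exact: Kgrp| | |exact: generated_K_s|].
- move=> k k0; rewrite iotaMn -iota0 => /iota_inj/(congr1 level).
  rewrite level_mulz level_ker ?raddf0 // => e; by move: k0; case: e => ->.
- by move=> _ [x Kx <-]; exact: s_conj_K.
apply/seteqP; split=> [g [/cycle_s[m _ <-] /hgt_K]|_ ->].
  by rewrite /hgt Zpart_iota level_mulz => ->; rewrite mulr0z.
by split; apply: sub_1; [exact: generated_subgroup|exact: Kgrp].
Qed.

(** * The Bass-Serre tree *)

Local Notation BS := (bass_serre K s).
Local Notation V := (vertex BS).

Lemma cosetP g : left_coset K g \in left_cosets K.
Proof. by rewrite inE; exists g. Qed.

Definition coset g : V := Sub (left_coset K g) (cosetP g).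

Lemma coset_eq g h : coset g = coset h <-> K (g^-1 * h)%g.
Proof.
rewrite -(left_coset_eq Kgrp); split=> [/(congr1 val)//|e].
exact: val_inj.
Qed.

Lemma coset_mulK g k : K k -> coset (g * k)%g = coset g.
Proof. by move=> Kk; apply/esym/coset_eq; rewrite mulKg. Qed.

Lemma coset_surj (v : V) : exists g, coset g = v.
Proof. by have := valP v; rewrite inE => -[g _ e]; exists g; exact: val_inj. Qed.

Definition rep (v : V) : G := sval (cid (coset_surj v)).

Lemma repK v : coset (rep v) = v.
Proof. by rewrite /rep; case: cid. Qed.

Lemma act_coset g h : @vact _ BS g (coset h) = coset (g * h)%g.
Proof. by apply: val_inj; rewrite /= translate_coset. Qed.

(** Since K is mapped into itself by conjugation by s, the coset g s K depends on
    g K only: each vertex has one edge going up, and the tree is described by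
    this parent map. *)
Definition coset_par (v : V) : V := coset (rep v * s)%g.
Definition coset_height (v : V) : int := hgt (rep v).

Lemma coset_par_coset g : coset_par (coset g) = coset (g * s)%g.
Proof.
apply/coset_eq; have /coset_eq/s_conj_K := repK (coset g).
by rewrite conjgE !invgM !mulgA.
Qed.

Lemma coset_height_coset g : coset_height (coset g) = hgt g.
Proof.
have /coset_eq/hgt_K e := repK (coset g).
by rewrite /coset_height -[g in RHS](mulVKg (rep (coset g))) hgtM e addr0.
Qed.

Lemma coset_height_par v : coset_height (coset_par v) = coset_height v + 1.
Proof. by rewrite -[v]repK coset_par_coset !coset_height_coset hgtM hgt_s. Qed.

Lemma coset_adjE (u v : V) :
  @adj _ BS u v = (v == coset_par u) || (u == coset_par v).
Proof.
have parn w : w <> coset_par w.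
  by move/(congr1 coset_height); rewrite coset_height_par; lia.
have half w : exists g, val w = left_coset K g /\
    val (coset_par w) = left_coset K (g * s)%g.
  by exists (rep w); split; rewrite // -[in LHS](repK w).
have back w w' g : val w = left_coset K g ->
    val w' = left_coset K (g * s)%g -> w' = coset_par w.
  move=> ew ew'; have -> : w = coset g by exact: val_inj.
  by rewrite coset_par_coset; exact: val_inj.
apply/asboolP/orP => [[_ [g [[eu ev]|[ev eu]]]]|[/eqP->|/eqP->]].
- by left; apply/eqP; exact: back eu ev.
- by right; apply/eqP; exact: back ev eu.
- by split; [exact: parn|have [g h] := half u; exists g; left].
- split; first by move=> e; exact: (parn v (esym e)).
  by have [g h] := half v; exists g; right.
Qed.

Lemma iter_coset_par i g : iter i coset_par (coset g) = coset (g * s ^+ i)%g.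
Proof.
elim: i => [|i IH]; first by rewrite expg0 mulg1.
by rewrite iterS IH coset_par_coset expgSr mulgA.
Qed.

Lemma coset_common_ancestor (u v : V) :
  exists i j, iter i coset_par u = iter j coset_par v.
Proof.
rewrite -[u]repK -[v]repK; set g := rep u; set g' := rep v.
have [i0 hi] := translate_on_line g; have [j0 hj] := translate_on_line g'.
pose N : int := (i0 + j0 + absz (hgt g) + absz (hgt g'))%N.
exists (absz (N - hgt g)%R), (absz (N - hgt g')%R); rewrite !iter_coset_par.
have [|k Kk ->] := hi (absz (N - hgt g)%R); first by rewrite /N; lia.
have [|k' Kk' ->] := hj (absz (N - hgt g')%R); first by rewrite /N; lia.
rewrite !coset_mulK //; congr (coset (iota (a *~ _))); rewrite /N; lia.
Qed.

Lemma bs_transitive (v : V) : exists g, @vact _ BS g (coset 1%g) = v.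
Proof. by exists (rep v); rewrite act_coset mulg1 repK. Qed.

Lemma bs_connected : graph_connected BS.
Proof. exact: parent_tree_connected coset_adjE coset_common_ancestor. Qed.

Lemma bs_is_tree : is_tree BS.
Proof.
apply: parent_tree_is_tree coset_height_par coset_adjE coset_common_ancestor _.
exact: inhabits (coset 1%g).
Qed.

Lemma bs_hyperbolic : hyperbolic_action (realization R BS).
Proof.
exact: parent_tree_hyperbolic coset_height_par coset_adjE coset_common_ancestor
  _ bs_transitive.
Qed.

(** * Comparison with the Cayley graph *)

Variable C : R.
Hypothesis C_top : exists z_top, C = rho z_top.
Hypothesis C_gt0 : 0 < C.

Local Notation A := (Q `|` Zrho iota rho C).
Local Notation Cay := (cayley A).

Lemma s_in_A : A s.
Proof.
right; exists a => //=; rewrite gtr0_norm //.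
by have [z eC] := C_top; rewrite eC; apply: a_min; rewrite -eC.
Qed.

Lemma ker_in_A z : rho z = 0 -> A (iota z).
Proof. by move=> rz; right; exists z => //=; rewrite rz normr0 ltW. Qed.

Lemma cay_connected : graph_connected Cay.
Proof.
apply: cayley_connected; apply/seteqP; split=> // g _.
have : generated (K `|` [set s]) g by rewrite generated_K_s.
apply: generated_sub; first exact: generated_subgroup.
move=> _ [[q Qq [z rz <-]]|->]; last by apply: sub_generated; exact: s_in_A.
apply: (sub_mul (generated_subgroup A)).
  by apply: sub_generated; left.
by apply: sub_generated; exact: ker_in_A.
Qed.

Local Notation dC g h :=
  (realization_dist (@vertex_pt R _ Cay g) (@vertex_pt R _ Cay h)).
Local Notation dT u v := (realization_dist (@vertex_pt R _ BS u) (vertex_pt R v)).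

Lemma cay_dist_gen g x : A x -> dC g (g * x)%g <= 1.
Proof.
move=> Ax; have [<-|gn] := pselect (g = g * x)%g.
  by rewrite realization_distxx ?ler01 //; exact: cay_connected.
apply/realization_dist_le/chain_adj/asboolP; split => //.
by exists x => //; left.
Qed.

(** An element of K is a product of one in Q and one in ker(rho), both generators. *)
Lemma cay_dist_K g k : K k -> dC g (g * k)%g <= 2.
Proof.
move=> [q Qq [z rz <-]]; rewrite mulgA.
apply: le_trans
    (realization_dist_triangle cay_connected _ (@vertex_pt R _ Cay (g * q)%g) _) _.
rewrite -[2]/(1 + 1); apply: lerD; apply: cay_dist_gen; first by left.
exact: ker_in_A.
Qed.

(** Choosing representatives of cosets: those of the ends of an edge differ by an
    element s k with k in K, of word length at most 1 + 2, and the choice is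
    equivariant up to an element of K, of word length at most 2. *)
Lemma bs_dominates_cay : dominated (realization R Cay) (realization R BS).
Proof.
have step u v : v = coset_par u -> dC (rep u) (rep v) <= 3.
  move=> e; have /coset_eq Kk : coset (rep u * s)%g = coset (rep v).
    by rewrite repK e.
  rewrite -(mulVKg (rep u * s)%g (rep v)).
  apply: le_trans
    (realization_dist_triangle cay_connected _ (@vertex_pt R _ Cay (rep u * s)%g) _) _.
  have := cay_dist_gen (rep u) s_in_A.
  by have := cay_dist_K (rep u * s)%g Kk; lra.
apply: (@vertex_map_dominated _ _ BS Cay rep 3 2) => //.
- exact: bs_connected.
- exact: cay_connected.
- move=> u v; rewrite coset_adjE => /orP[/eqP|/eqP] e; first exact: step.
  by rewrite realization_distC; exact: step.
move=> g v; have /coset_eq Kk : coset (g * rep v)%g = coset (rep (vact g v)).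
  by rewrite -act_coset !repK.
rewrite realization_distC -[X in dC _ X](mulVKg (g * rep v)%g).
exact: cay_dist_K.
Qed.

Lemma bs_dist_line g (i : nat) : dT (coset g) (coset (g * s ^+ i)%g) <= i%:R.
Proof.
elim: i => [|i IH].
  by rewrite expg0 mulg1 realization_distxx //; exact: bs_connected.
apply: le_trans
    (realization_dist_triangle bs_connected _ (vertex_pt R (coset (g * s ^+ i)%g)) _) _.
rewrite -natr1; apply: lerD => //; apply/realization_dist_le/chain_adj.
by rewrite coset_adjE expgSr mulgA coset_par_coset eqxx.
Qed.

(** Modulo K, the element iota(z) is the power of a of exponent rho z / rho a. *)
Lemma bs_dist_Zrho g z : `|rho z| <= C ->
  dT (coset g) (coset (g * iota z)%g) <= C / rho a.
Proof.
move=> zC.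
have bound (m : nat) : `|rho z| = rho a *~ m -> m%:R <= C / rho a.
  by move=> e; rewrite ler_pdivlMr // mulrC mulr_natr -[_ *+ _]/(_ *~ Posz _) -e.
have -> : coset (g * iota z)%g = coset (g * iota (a *~ level z))%g.
  have {1}-> : iota z = (iota (a *~ level z) * iota (z - a *~ level z))%g.
    by rewrite -iotaD addrC subrK.
  rewrite mulgA; apply: coset_mulK.
  by apply: ker_sub_K; exact: rho_residue.
have := levelP z; case: (level z) => m e.
  rewrite -iotaMn; apply: le_trans (bs_dist_line _ _) (bound _ _).
  by rewrite e ger0_norm // -mulrzr mulr_ge0 // ltW.
rewrite NegzE mulrNz iotaN -iotaMn realization_distC.
rewrite -{2}[g](mulgVK (s ^+ m.+1)%g).
apply: le_trans (bs_dist_line _ _) (bound _ _).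
by rewrite e NegzE mulrNz normrN ger0_norm // -mulrzr mulr_ge0 // ltW.
Qed.

(** Generators in Q fix the base vertex, and those in Zrho move it by at most
    C / rho a, so sending g to the coset g K is Lipschitz. *)
Lemma cay_dominates_bs : dominated (realization R BS) (realization R Cay).
Proof.
have Ca : 0 <= C / rho a by rewrite divr_ge0 // ltW.
have step g x : A x -> dT (coset g) (coset (g * x)%g) <= C / rho a.
  move=> [Qx|[z zC <-]]; last exact: bs_dist_Zrho.
  rewrite coset_mulK; last exact: Q_sub_K.
  by rewrite realization_distxx //; exact: bs_connected.
apply: (@vertex_map_dominated _ _ Cay BS coset (C / rho a) 0) => //.
- exact: cay_connected.
- exact: bs_connected.
- move=> g h /asboolP[_ [x Ax [->|->]]]; first exact: step.
  by rewrite realization_distC; exact: step.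
by move=> g h; rewrite act_coset realization_distxx //; exact: bs_connected.
Qed.

Lemma bs_represents : represented_by (@cayley_structure R G A) (realization R BS).
Proof.
split; first exact: bs_hyperbolic.
apply: action_class_eq.
- exact: realization_dist_triangle cay_connected.
- exact: realization_dist_triangle bs_connected.
- by split; [exact: bs_dominates_cay|exact: cay_dominates_bs].
Qed.

End SemidirectProduct.

Theorem proposition2p15 (R : realType) (G : groupType) (n : nat)
    (H : set G) (iota : 'rV[int]_n -> G)
    (HG : semidirect_Zn H iota)
    (rho : {additive 'rV[int]_n -> R})
    (rho_nontrivial : exists z, rho z <> 0)
    (rho_discrete : discrete_character rho)
    (gens : 'I_n -> 'rV[int]_n)
    (gensP : forall z, exists c : 'I_n -> int, z = \sum_(i < n) gens i *~ c i)
    (C_rho : R) (C_rho_gt0 : 0 < C_rho)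
    (C_rho_gens : forall i, `|rho (gens i)| <= C_rho)
    (C_rho_top : exists z_top, C_rho = rho z_top)
    (Q : set G) (Q_confining : confining H iota rho Q)
    (Q_subgroup : subgroup Q) :
  let cay := @cayley_structure R G (Q `|` Zrho iota rho C_rho) in
  let K := Qker iota rho Q in
  let minimal_positive (a : 'rV[int]_n) :=
    0 < rho a /\ (forall z, 0 < rho z -> rho a <= rho z) in
  [/\ hyperbolic_structures cay,
      exists2 T : simplicial_action G,
        is_tree T & represented_by cay (realization R T),
      exists a, minimal_positive a
    & forall a, minimal_positive a ->
        [/\ ascending_HNN K (iota a),
            is_tree (bass_serre K (iota a))
          & represented_by cay (realization R (bass_serre K (iota a)))]].
Proof.
move=> cay K minimal_positive.
have represented a : minimal_positive a ->
    represented_by cay (realization R (bass_serre K (iota a))).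
  move=> [a0 amin].
  exact: (bs_represents HG Q_confining Q_subgroup a0 amin C_rho_top C_rho_gt0).
have tree a : minimal_positive a -> is_tree (bass_serre K (iota a)).
  by move=> [a0 amin]; exact: (bs_is_tree HG Q_confining Q_subgroup a0 amin).
have [a ma] := minimal_positive_exists rho_nontrivial rho_discrete.
split; last 2 first.
- by exists a.
- move=> b mb; split; [|exact: tree|exact: represented].
  case: mb => b0 bmin.
  exact: (Qker_ascending_HNN HG Q_confining Q_subgroup b0 bmin).
- have [hyp e] := represented a ma.
  by exists (realization R (bass_serre K (iota a))).
- by exists (bass_serre K (iota a)); [exact: tree|exact: represented].
Qed.
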